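(* Assume $c(z,z)=0$ for all $z\in\mathcal Z$, and that there exist $\underline L\in\mathbb R$ and $(\bar\theta,\bar\lambda)\in\Theta\times[0,\infty)$ such that $\frac1n\sum_{i=1}^n\ell(\theta,\xi_i)\ge\underline L$ for all $\theta\in\Theta$, and $\overline V:=F(\bar\theta,\bar\lambda)<+\infty$. Then every minimizer $(\theta^\star,\lambda^\star)$ of $F$ on $\Theta\times[0,\infty)$ satisfies $$\lambda^\star\le\frac{\overline V-\underline L}{\rho}.$$
   Context: $\mathcal Z$ is a Polish space, $\Theta\subset\mathbb R^p$ is compact and convex, $\ell:\Theta\times\mathcal Z\to\mathbb R$ is a loss function, $c:\mathcal Z\times\mathcal Z\to[0,\infty)$ a cost function, $\rho>0$, and $\xi_1,\dots,\xi_n\in\mathcal Z$ are data points. For $(\theta,\lambda)\in\Theta\times[0,\infty)$, $$F(\theta,\lambda)=\frac1n\sum_{i=1}^n\sup_{z\in\mathcal Z}\big\{\ell(\theta,z)+\lambda(\rho-c(\xi_i,z))\big\}\in(-\infty,+\infty].$$ *)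

(* Defs.v *)
From HB Require Import structures.
From mathcomp Require Import all_boot all_order all_algebra.
From mathcomp Require Import all_classical all_reals all_analysis.

Set Implicit Arguments.
Unset Strict Implicit.
Unset Printing Implicit Defensive.

Import Order.TTheory GRing.Theory Num.Theory.
Import numFieldNormedType.Exports.

Local Open Scope classical_set_scope.
Local Open Scope ring_scope.

(* Completeness is stated with filters rather than through [completeType],
   because the latter also bundles a distinguished point. *)
Definition complete_metric (R : realType) (M : metricType R) : Prop :=
  forall F : set_system M, ProperFilter F -> cauchy F ->
    exists x : M, F --> x.

Definition completely_metrizable (R : realType) (Z : topologicalType) : Prop :=
  exists (M : metricType R) (f : Z -> M) (g : M -> Z),
    [/\ cancel f g, cancel g f, continuous f, continuous g
      & complete_metric M].

Definition separable_space (Z : topologicalType) : Prop :=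
  exists2 S : set Z, countable S & dense S.

Definition polish_space (R : realType) (Z : topologicalType) : Prop :=
  separable_space Z /\ completely_metrizable R Z.

(* [loss] is a total function on R^p; only its values on Theta are relevant. *)
Definition dual_objective (R : realType) (p n : nat) (Z : Type)
    (loss : 'rV[R]_p -> Z -> R) (c : Z -> Z -> R) (rho : R) (xi : 'I_n -> Z)
    (theta : 'rV[R]_p) (lambda : R) : \bar R :=
  ((n%:R^-1)%:E *
    \sum_(i < n) ereal_sup
      [set (loss theta z + lambda * (rho - c (xi i) z))%:E
        | z in [set: Z]])%E.

(* Main.v *)
(* Evaluating each supremum at [z = xi i], where the cost vanishes, gives
   [F theta lambda >= L + lambda * rho]; compare with the minimality bound
   [F thetastar lambdastar <= F thetabar lambdabar]. *)

Require Import Defs.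
From HB Require Import structures.
From mathcomp Require Import all_boot all_order all_algebra.
From mathcomp Require Import all_classical all_reals all_analysis.

Import Order.TTheory GRing.Theory Num.Theory.
Import numFieldNormedType.Exports.

Local Open Scope classical_set_scope.
Local Open Scope ring_scope.

Lemma dual_objective_ge (R : realType) (p n : nat) (Z : Type)
    (loss : 'rV[R]_p -> Z -> R) (c : Z -> Z -> R) (rho : R) (xi : 'I_n -> Z)
    (theta : 'rV[R]_p) (lambda : R) :
  (0 < n)%N -> (forall z, c z z = 0) ->
  ((n%:R^-1 * (\sum_(i < n) loss theta (xi i)) + lambda * rho)%:E <=
    dual_objective loss c rho xi theta lambda)%E.
Proof.
move=> n0 cxx; have nN0 : n%:R != 0 :> R by rewrite pnatr_eq0 -lt0n.
(* The constant [lambda * rho] is moved inside the average as [n] equal summands, whose total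
   [n%:R * (lambda * rho)] cancels against [n%:R^-1] by [nN0]. Both sides are then averages over
   [i], so the bound reduces to one inequality per data point. *)
have -> : n%:R^-1 * (\sum_(i < n) loss theta (xi i)) + lambda * rho =
    n%:R^-1 * \sum_(i < n) (loss theta (xi i) + lambda * rho).
  rewrite big_split /= mulrDr sumr_const card_ord -[X in _ = _ + _ * X]mulr_natl.
  by rewrite mulKf.
rewrite EFinM -sumEFin; apply: lee_wpmul2l.
  by rewrite lee_fin invr_ge0 ler0n.
apply: lee_sum => i _; apply: ereal_sup_ubound.
by exists (xi i) => //; rewrite cxx subr0.
Qed.

Theorem proposition2p2 (R : realType) (p n : nat) (hn : (0 < n)%N)
    (Z : topologicalType) (hZ : polish_space R Z)
    (Theta : set 'rV[R]_p)
    (hTheta_compact : compact Theta) (hTheta_convex : convex_set Theta)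
    (loss : 'rV[R]_p -> Z -> R)
    (c : Z -> Z -> R) (hc_ge0 : forall z z' : Z, 0 <= c z z')
    (rho : R) (hrho : 0 < rho)
    (xi : 'I_n -> Z)
    (F := dual_objective loss c rho xi)
    (hc_diag : forall z : Z, c z z = 0)
    (L : R) (thetabar : 'rV[R]_p) (lambdabar : R)
    (hthetabar : Theta thetabar) (hlambdabar : 0 <= lambdabar)
    (hL : forall theta : 'rV[R]_p, Theta theta ->
       L <= n%:R^-1 * \sum_(i < n) loss theta (xi i))
    (hV : (F thetabar lambdabar < +oo)%E)
    (thetastar : 'rV[R]_p) (lambdastar : R)
    (hthetastar : Theta thetastar) (hlambdastar : 0 <= lambdastar)
    (hmin : forall (theta : 'rV[R]_p) (lambda : R),
       Theta theta -> 0 <= lambda ->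
       (F thetastar lambdastar <= F theta lambda)%E) :
  (lambdastar%:E <= (F thetabar lambdabar - L%:E) * (rho^-1)%:E)%E.
Proof.
have lower theta lambda : Theta theta ->
    ((L + lambda * rho)%:E <= F theta lambda)%E.
  move=> /hL L_le.
  (* The empirical mean loss in the lemma's bound is weakened to its uniform lower bound [L]. *)
  apply: le_trans (dual_objective_ge _ _ _ _ _ _ _ _ _ _ hn hc_diag).
  by rewrite lee_fin lerD2r.
have := le_trans (lower _ lambdastar hthetastar) (hmin _ _ hthetabar hlambdabar).
(* The value is finite: [hV] rules out [+oo], and the real lower bound just obtained rules out
   [-oo]. What remains is to solve [L + lambdastar * rho <= v] for [lambdastar], dividing by
   [rho > 0]. *)
case: (F thetabar lambdabar) hV => [v| |] //= _.
by rewrite -EFinB -EFinM !lee_fin ler_pdivlMr // lerBrDl.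
Qed.
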